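(* Let $T\subsetneq\{1,\dots,d\}$, and let $\mathcal{S}=(S_i)_{i=1}^k$ be a partition of $\{1,\dots,d\}$ with $S_i\cap T\neq\emptyset$ for every $i$; put $\rho_i=|S_i|/d$ and $\alpha_i=|T\cap S_i|/|S_i|$. Then the optimal weights $\omega^*=(\omega_1^*,\dots,\omega_k^* )\in\mathbb{R}_+^k$, i.e. the minimizers of $\omega\mapsto\tilde m_{\mathcal{S},T,w}$, $w=\sum_{i=1}^k\omega_i1_{S_i}$, over $\mathbb{R}_+^k$, are given, up to multiplication by a common positive scalar, by the equations $$\alpha_i\,\omega_i^*=(1-\alpha_i)\sqrt{\frac{2}{\pi}}\int_{\omega_i^*}^\infty(x-\omega_i^* )\,e^{-x^2/2}\,dx,\qquad \omega_i^*\ge0,\quad i=1,\dots,k.$$ In particular, $\omega^*$ is independent of $\rho=(\rho_1,\dots,\rho_k)$ (it is determined by $\alpha=(\alpha_1,\dots,\alpha_k)$ alone).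
   Context: Here $\mathbb{R}_+=[0,\infty)$ and $1_{S_i}\in\mathbb{R}^d$ is the indicator vector of $S_i$. With $\sigma=|T|/d$ and, for $t\ge0$, $\varphi(t)=\sqrt{2/\pi}\int_t^\infty(x-t)^2e^{-x^2/2}\,dx$, define $$\tilde m_{\mathcal{S},T,w}=\inf_{\tau>0}\Big(\sigma+\sum_{i=1}^k\rho_i\big(\alpha_i(\omega_i\tau)^2+(1-\alpha_i)\varphi(\omega_i\tau)\big)\Big).$$ Equivalently, $\tilde m_{\mathcal{S},T,w}=\inf_{\tau>0}\mathbb{E}\big(d^{-1}\operatorname{dist}^2(g,\tau\,\partial_{x_0}\|\cdot\|_{1,w})\big)$ for any $x_0\in\mathbb{R}^d$ with support $T$ and $g$ a standard Gaussian vector, where $\|x\|_{1,w}=\sum_j w_j|x(j)|$. The minimizing weights are unique up to multiplication by a positive scalar. *)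

(* Defs.v *)
From mathcomp Require Import all_boot all_order all_algebra.
From mathcomp Require Import all_classical all_reals all_analysis.
Set Implicit Arguments.
Unset Strict Implicit.
Unset Printing Implicit Defensive.
Import Order.TTheory GRing.Theory Num.Theory.
Import numFieldNormedType.Exports.
Local Open Scope classical_set_scope.
Local Open Scope ring_scope.

(* The finite set {1, ..., d} is 'I_d, and an indexed partition (S_i)_{i=1}^k
   is S : 'I_k -> {set 'I_d}.  Injectivity is needed because the image
   S @: setT forgets repetitions. *)
Definition is_indexed_partition (d k : nat) (S : 'I_k -> {set 'I_d}) : Prop :=
  injective S /\ finset.partition [set S i | i in 'I_k]%SET [set: 'I_d]%SET.

Definition admissible (d k : nat) (S : 'I_k -> {set 'I_d}) (T : {set 'I_d}) :
    Prop :=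
  [/\ T \proper [set: 'I_d]%SET, is_indexed_partition S
    & forall i, S i :&: T != finset.set0].

Section Weights.
Variable R : realType.

Definition phi (t : R) : R :=
  Num.sqrt (2 / pi) *
    \int[lebesgue_measure]_(x in `[t, +oo[) ((x - t) ^+ 2 * expR (- x ^+ 2 / 2)).

Definition psi (t : R) : R :=
  Num.sqrt (2 / pi) *
    \int[lebesgue_measure]_(x in `[t, +oo[) ((x - t) * expR (- x ^+ 2 / 2)).

Section Config.
Variables (d k : nat) (S : 'I_k -> {set 'I_d}) (T : {set 'I_d}).

Definition sigma : R := #|T|%:R / d%:R.

Definition rho (i : 'I_k) : R := #|S i|%:R / d%:R.

Definition alpha (i : 'I_k) : R := #|T :&: S i|%:R / #|S i|%:R.

(* The weight vector w = \sum_i omega_i 1_{S_i} enters only through its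
   block values omega_i. The infimum is over a nonempty set of nonnegative
   reals, so the real-valued inf is the genuine one. *)
Definition mtilde (omega : 'rV[R]_k) : R :=
  inf [set sigma + \sum_(i < k) rho i *
             (alpha i * (omega 0 i * tau) ^+ 2 +
              (1 - alpha i) * phi (omega 0 i * tau))
      | tau in [set tau : R | 0 < tau]].

Definition nonneg_vec (omega : 'rV[R]_k) : Prop := forall i, 0 <= omega 0 i.

Definition optimal_weights (omega : 'rV[R]_k) : Prop :=
  nonneg_vec omega /\
  forall v : 'rV[R]_k, nonneg_vec v -> mtilde omega <= mtilde v.

Definition weight_equations (omega : 'rV[R]_k) : Prop :=
  forall i, alpha i * omega 0 i = (1 - alpha i) * psi (omega 0 i) /\
            0 <= omega 0 i.

End Config.
End Weights.

(* Main.v *)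
Require Import Defs.
From mathcomp Require Import all_boot all_order all_algebra ring lra.
From mathcomp Require Import all_classical all_reals all_analysis.
From mathcomp Require Import measurable_realfun.
Set Implicit Arguments.
Unset Strict Implicit.
Unset Printing Implicit Defensive.
Import Order.TTheory GRing.Theory Num.Theory.
Import numFieldNormedType.Exports.
Local Open Scope ring_scope.

(** Up to the constant sigma, the quantity minimized over tau is the separable
    sum of rho_i f_i(omega_i tau), where
    f_i(t) = alpha_i t^2 + (1 - alpha_i) phi(t).
    Ideally one would choose tau and omega so that each omega_i tau minimizes
    f_i, and the weights are free enough to do this for all blocks at once; the
    equation for omega_i^* is exactly f_i' = 0, since phi' = - 2 psi.

    No derivative is computed.  Integrating the convexity inequality of
    t |-> (x - t)_+^2 against the Gaussian weight gives the tangent inequality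
    phi(s) - 2 psi(s) (t - s) <= phi(t) ([phi_tangent]).  Together with the
    quadratic term, it turns a solution s of the block equation into a
    minimizer with a quadratic gap, f_i(t) >= f_i(s) + alpha_i (t - s)^2
    ([block_cost_gap]); uniqueness of s follows at once, and existence comes
    from the intermediate value theorem, psi being Lipschitz and nonincreasing.

    Let omega^* solve the equations and let m be the value of the sum at
    omega^*.  Every omega has mtilde(omega) >= m, with equality on the open ray
    of omega^* (take tau = 1/c).  Conversely, if mtilde(omega) = m, the gap says
    that the ray {tau omega : tau > 0} comes arbitrarily close to omega^* in a
    weighted Euclidean norm.  As T is a proper subset, some alpha_i < 1, and
    psi(0) > 0 forces omega_i^* <> 0; an open ray which comes arbitrarily close
    to a nonzero point contains it ([ray_approaches_point]).  Hence omega is a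
    positive multiple of omega^*.  The equations involve alpha only, whence the
    independence of rho. *)

(** * Truncated Gaussian moments phi and psi *)

Section TruncatedMoments.
Variable R : realType.
Implicit Types (h : R -> R) (s t x : R).
Local Notation mu := lebesgue_measure.

Definition gauss_weight x : R := expR (- x ^+ 2 / 2).

(** The positive part (x - t)_+ : integrals over the moving ray [t, +oo[
    become integrals of this function over the whole line, which can be compared
    pointwise for different t. *)
Definition excess t x : R := Num.max 0 (x - t).

Lemma measurable_gauss_weight : measurable_fun [set: R] gauss_weight.
Proof.
apply: measurableT_comp => //; apply: measurable_funM => //.
by apply: measurableT_comp => //; exact: measurable_funX.
Qed.

Lemma measurable_excess t : measurable_fun [set: R] (excess t).
Proof.
by apply: measurable_maxr => //; apply: measurable_funB.
Qed.

(** The normal law of variance 2 supplies an integrable function which decays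
    more slowly than the weight, exp(- x^2 / 4) against exp(- x^2 / 2). *)
Lemma normal_pdf_sqrt2 x :
  normal_pdf 0 (Num.sqrt 2) x = normal_peak (Num.sqrt 2) * expR (- x ^+ 2 / 4).
Proof.
have s0 : Num.sqrt 2 != 0 :> R by rewrite gt_eqF// sqrtr_gt0.
rewrite normal_pdfE//; congr (_ * expR _).
rewrite subr0 sqr_sqrtr//; congr (_ / _); ring.
Qed.

(** Half of the Gaussian exponent absorbs the quadratic growth, since
    1 + x^2 <= 4 exp(x^2 / 4); the other half is integrable. *)
Lemma integrable_gauss_growth h (C : R) : measurable_fun [set: R] h ->
  (forall x, `|h x| <= C * (1 + x ^+ 2)) ->
  mu.-integrable [set: R] (EFin \o (fun x => h x * gauss_weight x)).
Proof.
move=> mh hC.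
have p0 : 0 < normal_peak (Num.sqrt 2) :> R.
  by rewrite normal_peak_gt0// gt_eqF// sqrtr_gt0.
have C0 : 0 <= C.
  by have := le_trans (normr_ge0 _) (hC 0); rewrite expr0n addr0 mulr1.
have := integrable_normal_pdf 0 (Num.sqrt (2 : R)).
move/(integrableZl measurableT (4 * C / normal_peak (Num.sqrt 2))).
apply: le_integrable => //.
  apply/measurable_EFinP; apply: measurable_funM => //.
  exact: measurable_gauss_weight.
move=> x _ /=; rewrite lee_fin normal_pdf_sqrt2 normrM (ger0_norm (expR_ge0 _)).
apply: (le_trans (ler_wpM2r (expR_ge0 _) (hC x))).
rewrite (_ : 4 * C / _ * _ = 4 * C * expR (- x ^+ 2 / 4)); last first.
  by field; rewrite gt_eqF.
rewrite ger0_norm ?mulr_ge0 ?expR_ge0//.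
rewrite /gauss_weight.
have -> : - x ^+ 2 / 2 = - x ^+ 2 / 4 + - x ^+ 2 / 4 by field.
rewrite expRD mulrA ler_wpM2r ?expR_ge0//.
rewrite -mulrA (mulrC 4) ler_wpM2l//.
rewrite mulNr expRN ler_pdivrMr ?expR_gt0//.
have := expR_ge1Dx (x ^+ 2 / 4); nra.
Qed.

Lemma integrable_excess t :
  mu.-integrable [set: R] (EFin \o (fun x => excess t x * gauss_weight x)).
Proof.
apply: (@integrable_gauss_growth _ (1 + `|t|)); first exact: measurable_excess.
move=> x; rewrite /excess ger0_norm; last by rewrite le_max lexx.
have := ler_norm (- t); rewrite normrN => tt.
have x0 := sqr_ge0 x; have tx := mulr_ge0 (normr_ge0 t) x0.
have t0 := normr_ge0 t; have x1 := sqr_ge0 (x - 1).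
by rewrite ge_max; apply/andP; split; lra.
Qed.

Lemma integrable_excess_sqr t :
  mu.-integrable [set: R] (EFin \o (fun x => excess t x ^+ 2 * gauss_weight x)).
Proof.
apply: (@integrable_gauss_growth _ (2 * (1 + t ^+ 2))).
  by apply: measurable_funX; exact: measurable_excess.
move=> x; rewrite ger0_norm ?sqr_ge0// /excess.
by case: (leP 0 (x - t)) => _; nra.
Qed.

Lemma integrable_gauss_weight :
  mu.-integrable [set: R] (EFin \o gauss_weight).
Proof.
have -> : gauss_weight = (fun x => cst 1 x * gauss_weight x).
  by apply/funext => x; rewrite mul1r.
apply: (@integrable_gauss_growth _ 1) => // x.
by rewrite normr1 mul1r lerDl sqr_ge0.
Qed.

Lemma Rintegral_excessX (n : nat) (t : R) : (0 < n)%N ->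
  \int[mu]_(x in `[t, +oo[) ((x - t) ^+ n * expR (- x ^+ 2 / 2)) =
  \int[mu]_x (excess t x ^+ n * gauss_weight x).
Proof.
move=> n0; rewrite Rintegral_mkcond; apply: eq_Rintegral => x _.
rewrite patchE mem_setE in_itv/= andbT /excess.
have [tx|tx] := leP t x; first by rewrite (max_idPr _)// subr_ge0.
by rewrite (max_idPl _) ?expr0n ?gtn_eqF ?mul0r// subr_le0 ltW.
Qed.

Lemma phiE t :
  phi t = Num.sqrt (2 / pi) * \int[mu]_x (excess t x ^+ 2 * gauss_weight x).
Proof. by rewrite /phi Rintegral_excessX. Qed.

Lemma psiE t :
  psi t = Num.sqrt (2 / pi) * \int[mu]_x (excess t x * gauss_weight x).
Proof. by rewrite /psi -(@Rintegral_excessX 1). Qed.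

Lemma sqrt2pi_gt0 : 0 < Num.sqrt (2 / pi) :> R.
Proof. by rewrite sqrtr_gt0 divr_gt0// pi_gt0. Qed.

(** As phi' = - 2 psi, the left-hand side is the tangent line of the convex
    function phi at s.  The inequality holds under the integral sign:
    (x - t)_+^2 is convex in t with slope - 2 (x - s)_+ at s. *)
Lemma phi_tangent s t : phi s - 2 * psi s * (t - s) <= phi t.
Proof.
rewrite !phiE !psiE.
have c0 := sqrt2pi_gt0; set c := Num.sqrt _ in c0 *.
rewrite (_ : _ - _ = c * (\int[mu]_x (excess s x ^+ 2 * gauss_weight x) -
   (2 * (t - s)) * \int[mu]_x (excess s x * gauss_weight x))); last by ring.
rewrite ler_pM2l// -RintegralZl//; last exact: integrable_excess.
have iZ := integrableZl measurableT (2 * (t - s)) (integrable_excess s).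
have iB := integrableB measurableT (integrable_excess_sqr s) iZ.
rewrite -RintegralB//; last exact: integrable_excess_sqr.
apply: le_Rintegral => //; first exact: integrable_excess_sqr.
move=> x _; rewrite mulrA -mulrBl ler_wpM2r ?expR_ge0//.
rewrite /excess; case: (leP 0 (x - s)) => xs; case: (leP 0 (x - t)) => xt.
- by have := sqr_ge0 (t - s); nra.
- have tx : 0 <= t - x by lra.
  by have := mulr_ge0 xs tx; nra.
- by have := sqr_ge0 (x - t); nra.
- by nra.
Qed.

Lemma psi_ge0 t : 0 <= psi t.
Proof.
rewrite psiE mulr_ge0 ?(ltW sqrt2pi_gt0)//; apply: Rintegral_ge0 => x _.
by rewrite mulr_ge0 ?expR_ge0// le_max lexx.
Qed.

Lemma psi_nonincreasing s t : s <= t -> psi t <= psi s.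
Proof.
move=> st; rewrite !psiE ler_pM2l ?sqrt2pi_gt0//.
apply: le_Rintegral => //; [exact: integrable_excess..|move=> x _].
rewrite ler_wpM2r ?expR_ge0// /excess.
by rewrite ge_max !le_max lexx/= lerD2l lerN2 st orbT.
Qed.

(** On [1, 2] the integrand x exp(- x^2 / 2) is at least exp(-2). *)
Lemma psi0_gt0 : 0 < psi 0 :> R.
Proof.
rewrite psiE mulr_gt0 ?sqrt2pi_gt0//.
have m12 : measurable (`[1, 2]%classic : set R) by exact: measurable_itv.
have i12 := @integrable_indic_itv R 1 2 true false.
apply: (@lt_le_trans _ _
  (\int[mu]_x (expR (- 2) * \1_(`[1, 2]%classic : set R) x))).
  rewrite RintegralZl// mulr_gt0 ?expR_gt0//.
  rewrite /Rintegral integral_indic// setIT.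
  have /= -> := @lebesgue_measure_itv R `[1, 2]%R.
  by rewrite lte_fin ltr1n /=; lra.
apply: le_Rintegral => //.
- exact: (integrableZl measurableT (expR (- 2)) i12).
- exact: integrable_excess.
move=> x _; rewrite indicE mem_setE in_itv/= /excess subr0.
case: andP => [[x1 x2]|_] /=; last first.
  by rewrite mulr0 mulr_ge0 ?expR_ge0// le_max lexx.
rewrite mulrC ler_pM ?expR_ge0//.
  by rewrite le_max x1 orbT.
by rewrite ler_expR; nra.
Qed.

(** psi is Lipschitz because t |-> (x - t)_+ is 1-Lipschitz for every x. *)
Lemma continuous_psi : continuous (@psi R).
Proof.
pose K := Num.sqrt (2 / pi) * \int[mu]_x gauss_weight x.
have K0 : 0 <= K.
  by rewrite mulr_ge0 ?sqrtr_ge0//; apply: Rintegral_ge0 => x _;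
    exact: expR_ge0.
have lip s t : s <= t -> psi s - psi t <= K * (t - s).
  move=> st; rewrite !psiE /K -mulrBr -mulrA ler_pM2l ?sqrt2pi_gt0//.
  rewrite -RintegralB//; try exact: integrable_excess.
  rewrite mulrC -RintegralZl//; last exact: integrable_gauss_weight.
  apply: le_Rintegral => //.
  - exact: (integrableB measurableT (integrable_excess s)
                                     (integrable_excess t)).
  - exact: (integrableZl measurableT (t - s) integrable_gauss_weight).
  move=> x _; rewrite -mulrBl ler_wpM2r ?expR_ge0// /excess.
  by case: (leP 0 (x - s)) => ?; case: (leP 0 (x - t)) => ?; lra.
move=> s; apply/cvgrPdist_le => /= e e0; near=> t.
have Kst : K * `|s - t| <= e.
  (* K + 1 rather than K keeps the divisor positive. *)
  have -> : e = (K + 1) * (e / (K + 1)) by field; lra.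
  rewrite ler_pM//; first lra.
  near: t; apply: cvgr_dist_le; first exact: cvg_id.
  by rewrite divr_gt0//; lra.
apply: (le_trans _ Kst); have [st|/ltW ts] := leP s t.
  by rewrite ger0_norm ?subr_ge0 ?psi_nonincreasing//
    (distrC s) [`|t - s|]ger0_norm ?subr_ge0// lip.
by rewrite distrC ger0_norm ?subr_ge0 ?psi_nonincreasing//
  [`|s - t|]ger0_norm ?subr_ge0// lip.
Unshelve. all: by end_near.
Qed.

End TruncatedMoments.

(** * The cost of a single block *)

Section Blocks.
Variable R : realType.
Implicit Types a s t : R.

Definition block_cost a t : R := a * t ^+ 2 + (1 - a) * phi t.

(** The equation says that the tangent line of (1 - a) phi at s has slope
    - 2 a s, opposite to that of a t^2.  Adding [phi_tangent] cancels the linear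
    terms and leaves a (t^2 - s^2) - 2 a s (t - s) = a (t - s)^2. *)
Lemma block_cost_gap a s t : a <= 1 -> a * s = (1 - a) * psi s ->
  block_cost a s + a * (t - s) ^+ 2 <= block_cost a t.
Proof.
move=> a1 eqs; rewrite /block_cost.
have a1' : 0 <= 1 - a by lra.
have := ler_wpM2l a1' (phi_tangent s t).
have -> : (1 - a) * (phi s - 2 * psi s * (t - s)) =
  (1 - a) * phi s - 2 * (a * s) * (t - s) by rewrite eqs; ring.
lra.
Qed.

(** Applying the gap in both directions gives 2 a (t - s)^2 <= 0. *)
Lemma block_equation_unique a s t : 0 < a <= 1 ->
  a * s = (1 - a) * psi s -> a * t = (1 - a) * psi t -> s = t.
Proof.
move=> /andP[a0 a1] es et.
have st := block_cost_gap t a1 es; have ts := block_cost_gap s a1 et.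
have sq : (t - s) ^+ 2 <= 0 by nra.
have : t - s == 0 by rewrite -sqrf_eq0 eq_le sq sqr_ge0.
by rewrite subr_eq0 => /eqP.
Qed.

(** The difference of the two sides is nonpositive at 0, and nonnegative at
    (1 - a) psi(0) / a because psi is nonincreasing. *)
Lemma block_equation_solvable a : 0 < a <= 1 ->
  exists2 s, 0 <= s & a * s = (1 - a) * psi s.
Proof.
move=> /andP[a0 a1].
pose b : R := (1 - a) * psi 0 / a.
have p0 : 0 <= (1 - a) * psi (0 : R) by rewrite mulr_ge0 ?psi_ge0// subr_ge0.
have b0 : 0 <= b by rewrite divr_ge0// ltW.
pose f t := a * t - (1 - a) * psi t.
have fc : continuous f.
  move=> t; apply: cvgB; apply: cvgMr; first exact: cvg_id.
  exact: continuous_psi.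
have f0 : f 0 <= 0 by rewrite /f mulr0 sub0r oppr_le0.
have fb : 0 <= f b.
  rewrite /f subr_ge0 /b (mulrC a) divfK ?gt_eqF//.
  by rewrite ler_wpM2l ?subr_ge0// psi_nonincreasing.
have [|s] := @IVT R f 0 b 0 b0 (continuous_subspaceT fc).
  by rewrite ge_min f0 le_max fb orbT.
rewrite in_itv/= => /andP[s0 _] /eqP; rewrite subr_eq0 => /eqP fs.
by exists s.
Qed.

Lemma block_equation_neq0 a s : a < 1 -> a * s = (1 - a) * psi s -> s != 0.
Proof.
move=> a1 es; apply/eqP => s0; move: es; rewrite s0 mulr0 => /esym/eqP.
by rewrite mulf_eq0 !gt_eqF ?psi0_gt0// subr_gt0.
Qed.

End Blocks.

(** * Distance from a point to an open ray *)

Section Ray.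
Variables (R : realType) (I : finType) (c w s : I -> R).

(** The squared distance q(x) = b x^2 - 2 a x + q(0) is a quadratic polynomial
    in x.  If a <= 0 it stays above q(0) > 0 for x > 0, so a > 0; the vertex
    x = a / b is then positive, and the infimum 0 of q is attained there. *)
Lemma ray_approaches_point : (forall i, 0 < c i) -> (exists i, s i != 0) ->
  (forall e, 0 < e ->
     exists2 x, 0 < x & \sum_i c i * (x * w i - s i) ^+ 2 < e) ->
  exists2 x, 0 < x & forall i, x * w i = s i.
Proof.
move=> c0 [i0 si0] near.
pose b := \sum_i c i * w i ^+ 2.
pose a := \sum_i c i * (w i * s i).
pose q x := \sum_i c i * (x * w i - s i) ^+ 2.
have q0 : 0 < \sum_i c i * s i ^+ 2.
  rewrite (bigD1 i0)//=; apply: ltr_pwDl.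
    by rewrite mulr_gt0 ?exprn_even_gt0.
  by apply: sumr_ge0 => i _; rewrite mulr_ge0 ?sqr_ge0// ltW.
have qE x : q x = b * x ^+ 2 - 2 * a * x + \sum_i c i * s i ^+ 2.
  rewrite /q /a /b mulr_suml mulrAC mulr_sumr -sumrB -big_split/=.
  by apply: eq_bigr => i _; ring.
have b0 : 0 <= b by apply: sumr_ge0 => i _; rewrite mulr_ge0 ?sqr_ge0// ltW.
have a0 : 0 < a.
  rewrite ltNge; apply/negP => a0.
  have [x x0] := near _ q0; rewrite -/(q x) qE.
  have := mulr_ge0 b0 (sqr_ge0 x); nra.
(* If b = 0 then w = 0, and a = 0. *)
have {}b0 : 0 < b.
  rewrite lt_neqAle b0 andbT eq_sym; apply/eqP => /psumr_eq0P bE.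
  have : a = 0.
    apply: big1 => i _.
    have /eqP := bE (fun i _ => mulr_ge0 (ltW (c0 i)) (sqr_ge0 _)) i isT.
    by rewrite mulf_eq0 gt_eqF//= sqrf_eq0 => /eqP ->; rewrite mul0r mulr0.
  by move: a0 => /[swap] ->; rewrite ltxx.
have xmin0 : 0 < a / b by rewrite divr_gt0.
have qmin x : q (a / b) <= q x.
  have sq : q x - q (a / b) = b * (x - a / b) ^+ 2.
    by rewrite !qE; field; rewrite gt_eqF.
  by rewrite -subr_ge0 sq mulr_ge0 ?sqr_ge0// ltW.
have qmin0 : q (a / b) = 0.
  apply/eqP; rewrite eq_le sumr_ge0 ?andbT; last first.
    by move=> i _; rewrite mulr_ge0 ?sqr_ge0// ltW.
  rewrite leNgt; apply/negP => /near[x _].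
  by rewrite -/(q x) ltNge qmin.
exists (a / b) => // i; apply/eqP; rewrite -subr_eq0 -sqrf_eq0.
move: qmin0 => /psumr_eq0P qE0.
have /eqP := qE0 (fun i _ => mulr_ge0 (ltW (c0 i)) (sqr_ge0 _)) i isT.
by rewrite mulf_eq0 gt_eqF.
Qed.

End Ray.

(** * Minimizing over all blocks *)

Section Admissible.
Variables (R : realType) (d k : nat) (S : 'I_k -> {set 'I_d}) (T : {set 'I_d}).
Hypothesis hST : admissible S T.

Lemma block_card_gt0 i : (0 < #|S i|)%N.
Proof.
case: hST => _ _ /(_ i) /finset.set0Pn[x]; rewrite finset.inE => /andP[xS _].
by rewrite card_gt0; apply/finset.set0Pn; exists x.
Qed.

Lemma alpha_bounds i : 0 < alpha R S T i <= 1.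
Proof.
rewrite divr_gt0 ?ltr0n ?block_card_gt0//=; last first.
  by case: hST => _ _ /(_ i); rewrite finset.setIC -card_gt0.
rewrite ler_pdivrMr ?ltr0n ?block_card_gt0// mul1r ler_nat.
by rewrite subset_leq_card// finset.subsetIr.
Qed.

(** This is where T being a proper subset enters: an element outside T lies in
    some block, which T then does not fill. *)
Lemma exists_block_off_support : exists i, alpha R S T i < 1.
Proof.
case: hST => /properP[_ [x _ xT]] [_ /and3P[/eqP cov _ _]] _.
have : x \in finset.cover [set S i | i in 'I_k]%SET by rewrite cov finset.inE.
move=> /finset.bigcupP[_ /finset.imsetP[i _ ->] xS]; exists i.
rewrite ltr_pdivrMr ?ltr0n ?block_card_gt0// mul1r ltr_nat proper_card//.
apply/properP; split; first exact: finset.subsetIr.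
by exists x => //; rewrite finset.inE (negbTE xT).
Qed.

Lemma rho_gt0 i : 0 < rho R S i.
Proof.
have Si := block_card_gt0 i.
rewrite divr_gt0 ?ltr0n// (leq_trans Si)//.
by rewrite -[leqRHS](card_ord d) max_card.
Qed.

Definition scaled_cost (omega : 'rV[R]_k) (x : R) : R :=
  sigma R T +
    \sum_(i < k) rho R S i * block_cost (alpha R S T i) (omega 0 i * x).

Lemma mtildeE omega :
  mtilde S T omega =
    inf [set scaled_cost omega x | x in [set x : R | 0 < x]]%classic.
Proof. by []. Qed.

Variable ostar : 'rV[R]_k.
Hypothesis ostarE : weight_equations S T ostar.

(** The block gaps add up, so the excess over the value at [ostar] dominates a
    weighted squared distance from x omega to [ostar]. *)
Lemma scaled_cost_gap (omega : 'rV[R]_k) (x : R) :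
  scaled_cost ostar 1 +
    \sum_i rho R S i * alpha R S T i * (x * omega 0 i - ostar 0 i) ^+ 2
  <= scaled_cost omega x.
Proof.
rewrite /scaled_cost -addrA lerD2l -big_split/=; apply: ler_sum => i _.
rewrite -mulrA -mulrDr ler_pM2l ?rho_gt0// mulr1 (mulrC x).
by apply: block_cost_gap; [case/andP: (alpha_bounds i)|case: (ostarE i)].
Qed.

Lemma scaled_cost_min omega x : scaled_cost ostar 1 <= scaled_cost omega x.
Proof.
apply: le_trans (scaled_cost_gap omega x); rewrite lerDl sumr_ge0// => i _.
have /andP[a0 _] := alpha_bounds i.
by rewrite mulr_ge0 ?sqr_ge0// mulr_ge0 ?ltW// rho_gt0.
Qed.

Lemma mtilde_min omega : scaled_cost ostar 1 <= mtilde S T omega.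
Proof.
rewrite mtildeE; apply: lb_le_inf.
  by exists (scaled_cost omega 1); exists 1 => //=.
by move=> _ [x _ <-]; exact: scaled_cost_min.
Qed.

Lemma mtilde_scaled_weights c : 0 < c ->
  mtilde S T (c *: ostar) = scaled_cost ostar 1.
Proof.
move=> c0; apply/eqP; rewrite eq_le mtilde_min andbT mtildeE; apply: ge_inf.
  by exists (scaled_cost ostar 1) => _ [x _ <-]; exact: scaled_cost_min.
exists c^-1; first by rewrite /= invr_gt0.
rewrite /scaled_cost; congr (_ + _); apply: eq_bigr => i _.
by rewrite mxE mulr1 (mulrAC c) divff ?gt_eqF// mul1r.
Qed.

(** An optimal omega has mtilde(omega) equal to the global lower bound, so by
    [scaled_cost_gap] its ray comes arbitrarily close to [ostar]. *)
Lemma optimal_weightsP omega :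
  optimal_weights S T omega <-> exists c, 0 < c /\ omega = c *: ostar.
Proof.
split=> [[_ opt]|[c [c0 ->]]]; last first.
  split=> [i|v _]; last by rewrite mtilde_scaled_weights// mtilde_min.
  by rewrite mxE mulr_ge0 ?(ltW c0)//; case: (ostarE i).
have ostar0 : nonneg_vec ostar by move=> i; case: (ostarE i).
have le_om : mtilde S T omega <= scaled_cost ostar 1.
  by rewrite -(mtilde_scaled_weights ltr01) scale1r; exact: opt.
have [||e e0|x x0 xE] := @ray_approaches_point R 'I_k
    (fun i => rho R S i * alpha R S T i) (omega 0) (ostar 0).
- by move=> i; have /andP[a0 _] := alpha_bounds i; rewrite mulr_gt0// rho_gt0.
- have [i ai] := exists_block_off_support; exists i.
  by case: (ostarE i) => /(block_equation_neq0 ai).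
- have hinf : has_inf
      [set scaled_cost omega x | x in [set x : R | 0 < x]]%classic.
    split; first by exists (scaled_cost omega 1); exists 1 => //=.
    by exists (scaled_cost ostar 1) => _ [x _ <-]; exact: scaled_cost_min.
  have [_ [x x0 <-]] := inf_adherent e0 hinf; rewrite -mtildeE => lt_om.
  by exists x => //; have := scaled_cost_gap omega x; lra.
- exists x^-1; rewrite invr_gt0; split=> //; apply/rowP => i.
  by rewrite mxE -xE mulKf// gt_eqF.
Qed.

Lemma weight_equationsP omega : weight_equations S T omega <-> omega = ostar.
Proof.
split=> [om|->//]; apply/rowP => i.
have [[e1 _] [e2 _]] := (om i, ostarE i).
exact: (block_equation_unique (alpha_bounds i) e1 e2).
Qed.

End Admissible.

Lemma weight_equations_solvable (R : realType) (d k : nat)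
    (S : 'I_k -> {set 'I_d}) (T : {set 'I_d}) : admissible S T ->
  exists omega : 'rV[R]_k, weight_equations S T omega.
Proof.
move=> hST.
have sol i := cid2 (block_equation_solvable (alpha_bounds R hST i)).
exists (\row_i s2val (sol i)) => i; rewrite mxE.
by case: (sol i).
Qed.

Theorem corollary11 (R : realType) (d k : nat) (T : {set 'I_d})
    (S : 'I_k -> {set 'I_d}) (hST : admissible S T) :
  (exists omega_star : 'rV[R]_k,
     (forall omega : 'rV[R]_k,
        weight_equations S T omega <-> omega = omega_star) /\
     (forall omega : 'rV[R]_k,
        optimal_weights S T omega <->
        exists c : R, 0 < c /\ omega = c *: omega_star)) /\
  (forall (d' : nat) (T' : {set 'I_d'}) (S' : 'I_k -> {set 'I_d'}),
     admissible S' T' ->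
     (forall i : 'I_k, alpha R S T i = alpha R S' T' i) ->
     forall omega : 'rV[R]_k,
       optimal_weights S T omega <-> optimal_weights S' T' omega).
Proof.
have [ostar ostarE] := @weight_equations_solvable R d k S T hST.
split.
  exists ostar; split=> omega; first exact: weight_equationsP.
  exact: optimal_weightsP.
move=> d' T' S' hST' alphaE omega.
have ostarE' : weight_equations S' T' ostar.
  by move=> i; rewrite -alphaE; exact: ostarE.
by split=> /optimal_weightsP om; apply/optimal_weightsP => //; exact: om.
Qed.
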